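(* Let $(X,d)$ be a metric space and let $M$ be a nonempty closed proper subset of $X$. Let $F:X\setminus M\to(0,\infty)$ be a function. Define $$v(x,y)=2\log\frac{d(x,y)+\max\{F(x),F(y)\}}{\sqrt{F(x)F(y)}},\qquad x,y\in X\setminus M.$$ Then: (1) $(X\setminus M,v)$ is a Gromov hyperbolic metric space with a Gromov constant $\delta\le\log4$, and the identity map $1_{X\setminus M}:(X\setminus M,d)\to(X\setminus M,v)$ is open. (2) If $F$ is $1$-Lipschitz on $(X\setminus M,d)$, then the identity map $1_{X\setminus M}:(X\setminus M,d)\to(X\setminus M,v)$ is $\frac52$-quasiconformal. (3) If $F$ has a continuous extension $\widetilde F$ to $(X,d)$ with $\widetilde F(x)=0$ for every $x\in M$, and $(X,d)$ is complete, then $(X\setminus M,v)$ is also a complete metric space.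
   Context: $\log$ is the natural logarithm. $F$ is $1$-Lipschitz if $|F(x)-F(y)|\le d(x,y)$ for all $x,y\in X\setminus M$. A metric space $(S,\rho)$ is Gromov hyperbolic with Gromov constant $\delta\ge 0$ if for all $x,y,z,w\in S$ $$\rho(x,z)+\rho(y,w)\le\max\{\rho(x,w)+\rho(y,z),\ \rho(x,y)+\rho(z,w)\}+2\delta .$$ A map is open if it sends open sets to open sets. For a homeomorphism $f:(Y,\rho)\to(Z,\sigma)$ between metric spaces, $x\in Y$ and $r>0$, set $$H_f(x,r)=\frac{\sup\{\sigma(f(x),f(y)):y\in Y,\ \rho(x,y)\le r\}}{\inf\{\sigma(f(x),f(y)):y\in Y,\ \rho(x,y)\ge r\}}$$ (with $\inf\emptyset=+\infty$, and the quotient understood as $0$ in that case when the numerator is finite). For a constant $0\le H<\infty$, a map $f:(Y,\rho)\to(Z,\sigma)$ is $H$-quasiconformal if it is a homeomorphism and $\limsup_{r\to0}H_f(x,r)\le H$ for every $x\in Y$. *)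

(* Defs.v *)
From HB Require Import structures.
From mathcomp Require Import all_boot all_order all_algebra.
From mathcomp Require Import all_classical all_reals all_analysis.

Set Implicit Arguments.
Unset Strict Implicit.
Unset Printing Implicit Defensive.

Import Order.TTheory GRing.Theory Num.Theory.
Import numFieldNormedType.Exports.

Local Open Scope classical_set_scope.
Local Open Scope ring_scope.

(* The library equips the type of a set [A] with the induced pseudometric (and
   hence the subspace topology); this completes it to the restricted metric. *)
Section subtype_metric.
Context {R : realType} {X : metricType R} (A : set X).

Let sdist (x y : A) : R := mdist (set_val x) (set_val y).

Let sdist_ge0 x y : 0 <= sdist x y.
Proof. exact: mdist_ge0. Qed.

Let sdist_positivity x y : sdist x y = 0 -> x = y.
Proof. by move=> /mdist_positivity; exact: val_inj. Qed.

Let sballE (x : A) (e : R) : ball x e = [set y | sdist x y < e].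
Proof.
rewrite -[LHS](@initial_ballE R A X set_val e x).
by apply/seteqP; split => y /=; rewrite ballEmdist.
Qed.

HB.instance Definition _ := @PseudoMetric_isMetric.Build R (A : Type)
  sdist sdist_ge0 sdist_positivity sballE.

End subtype_metric.

Lemma mdist_subtypeE (R : realType) (X : metricType R) (A : set X) (x y : A) :
  mdist x y = mdist (set_val x) (set_val y).
Proof. by []. Qed.

Record is_metric (R : realType) (T : Type) (rho : T -> T -> R) : Prop :=
  IsMetric {
    is_metric_xx : forall x, rho x x = 0;
    is_metric_eq : forall x y, rho x y = 0 -> x = y;
    is_metric_sym : forall x y, rho x y = rho y x;
    is_metric_triangle : forall y x z, rho x z <= rho x y + rho y z }.

(* A copy of [T] whose metric, uniform and topological structures are those of
   [rho], whatever structures [T] already carries. *)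
Definition metric_of (R : realType) (T : choiceType) (rho : T -> T -> R)
  (h : is_metric rho) : Type := T.

Section metric_of_instance.
Context {R : realType} {T : choiceType} {rho : T -> T -> R}.
Variable h : is_metric rho.

HB.instance Definition _ := Choice.copy (metric_of h) T.
HB.instance Definition _ := @isMetric.Build R (metric_of h) rho
  (is_metric_xx h) (is_metric_eq h) (is_metric_sym h) (is_metric_triangle h).

Definition id_metric_of (x : T) : metric_of h := x.

Lemma mdist_metric_ofE (x y : metric_of h) : mdist x y = rho x y.
Proof. by []. Qed.

End metric_of_instance.

Definition gromov_constant (R : realType) (S : metricType R) (delta : R) : Prop :=
  0 <= delta /\
  forall x y z w : S,
    mdist x z + mdist y w <=
    Num.max (mdist x w + mdist y z) (mdist x y + mdist z w) + 2 * delta.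

Definition open_map (Y Z : topologicalType) (f : Y -> Z) : Prop :=
  forall U : set Y, open U -> open (f @` U).

Definition homeomorphism (Y Z : topologicalType) (f : Y -> Z) : Prop :=
  continuous f /\
  exists g : Z -> Y, [/\ cancel f g, cancel g f & continuous g].

(* The infimum of the empty set is +oo, and [a / +oo] is 0. When [f] is a
   homeomorphism and [r > 0], continuity of the inverse makes the denominator
   positive, and continuity of [f] makes the numerator finite for small [r];
   so the values of 0 / 0 and +oo / +oo play no role in the limsup below. *)
Definition linear_dilatation (R : realType) (Y Z : metricType R) (f : Y -> Z)
    (x : Y) (r : R) : \bar R :=
  (ereal_sup [set (mdist (f x) (f y))%:E | y in [set y | (mdist x y <= r)%R]] /
   ereal_inf [set (mdist (f x) (f y))%:E | y in [set y | (r <= mdist x y)%R]])%E.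

Definition quasiconformal (R : realType) (Y Z : metricType R) (H : R)
    (f : Y -> Z) : Prop :=
  [/\ 0 <= H, homeomorphism f &
      forall x : Y, (limf_esup (linear_dilatation f x) 0^'+ <= H%:E)%E].

(* Stated with sequences since the library's [completeType] requires a
   distinguished point. *)
Definition complete_metric (R : realType) (T : metricType R) : Prop :=
  forall u : nat -> T, cauchy (u n @[n --> \oo]) ->
    exists l : T, u n @[n --> \oo] --> l.

Definition log_metric (R : realType) (X : metricType R) (M : set X)
    (F : ~` M -> R) (x y : ~` M) : R :=
  2 * ln ((mdist x y + Num.max (F x) (F y)) / Num.sqrt (F x * F y)).

(* Main.v *)
Require Import Defs.
From HB Require Import structures.
From mathcomp Require Import all_boot all_order all_algebra.
From mathcomp Require Import all_classical all_reals all_analysis.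
From mathcomp Require Import ring lra.

Set Implicit Arguments.
Unset Strict Implicit.
Unset Printing Implicit Defensive.

Import Order.TTheory GRing.Theory Num.Theory.
Import numFieldNormedType.Exports.

Local Open Scope classical_set_scope.
Local Open Scope ring_scope.

(** Write [d] for the given distance, [t = F x], and let
    [c x y = d(x, y) + max (F x) (F y)] be the gauge inside the logarithm, so
    that [v x y = 2 ln (c x y) - ln (F x) - ln (F y)]
    ([log_metricE]).  Taking logarithms turns products of values of [c] into
    sums of values of [v], and the weights [F] cancel whenever each point
    occurs equally often on both sides; so the metric properties of [v] are
    multiplicative properties of [c].

    - Triangle inequality: [c x z * F y <= c x y * c y z]
      ([log_gauge_weighted_triangle]).
    - Hyperbolicity: [c] itself satisfies the triangle inequality (it fails to
      be a metric only in being positive on the diagonal), and for any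
      symmetric nonnegative function with that property the product of the two
      diagonals of a quadrilateral is at most four times the larger product of
      opposite sides ([four_point_product]). The logarithm of this is the
      four-point condition with constant [ln 4].
    - Topology: [v x y <= 2 ln (1 + s)] forces [F y <= (1 + s)^2 F x] and
      [d(x, y) <= s max (F x) (F y)] ([log_metric_small]), so [v]-balls shrink
      to points for [d] and the identity is open.  Conversely [v x y] is small
      when [d(x, y)] and [|F x - F y|] are both small compared with [t]
      ([log_metric_le_near]).
    - Quasiconformality: at scale [r = u t] with [u] small, [v x y <= 4 u]
      when [d(x, y) <= r] (this uses the Lipschitz condition), and
      [v x y >= 8 u / 5] when [d(x, y) >= r] ([log_metric_ge_far], for an
      arbitrary positive [F]).  The quotient of the two bounds is [5/2], so
      the dilatation is at most [5/2] for every small [r].  As [u] tends to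
      [0] the constants 4 and 8/5 could be pushed to 3 and 2.
    - Completeness: along a [v]-Cauchy sequence [F] stays between two positive
      constants, hence the sequence is [d]-Cauchy.  At its limit in [X] the
      extension of [F] is still positive, so the limit is not in [M], and
      continuity of [F] there gives convergence for [v]
      ([log_metric_cvg]). *)

(** * A four-point inequality *)

(** The two sides adjacent to a shortest side are opposite to each other, and
    each diagonal is at most the shortest side plus one of them, hence at most
    twice that one. *)
Lemma four_point_product (R : realFieldType) (S : Type) (c : S -> S -> R) :
  (forall x y, 0 <= c x y) -> (forall x y, c x y = c y x) ->
  (forall y x z, c x z <= c x y + c y z) ->
  forall x y z w,
    c x z * c y w <= 4 * (c x w * c y z) \/
    c x z * c y w <= 4 * (c x y * c z w).
Proof.
move=> c_ge0 c_sym c_tri x y z w.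
have double (a b a' b' : R) : 0 <= a -> 0 <= b ->
    a <= a' + a' -> b <= b' + b' -> a * b <= 4 * (a' * b').
  move=> a0 b0 aa' bb'.
  have -> : 4 * (a' * b') = (a' + a') * (b' + b') by ring.
  exact: ler_pM.
have xyz := c_tri y x z; have xwz := c_tri w x z.
have yxw := c_tri x y w; have yzw := c_tri z y w.
rewrite (c_sym y x) in yxw; rewrite (c_sym w z) in xwz.
(* The nested comparisons single out a shortest side. *)
have [xw_yz|yz_xw] := lerP (c x w) (c y z);
  have [xy_zw|zw_xy] := lerP (c x y) (c z w).
- have [xw_xy|xy_xw] := lerP (c x w) (c x y).
    by right; rewrite [c x y * _]mulrC; apply: double => //; lra.
  by left; rewrite [c x w * _]mulrC; apply: double => //; lra.
- have [xw_zw|zw_xw] := lerP (c x w) (c z w).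
    by right; rewrite [c x y * _]mulrC; apply: double => //; lra.
  by left; apply: double => //; lra.
- have [yz_xy|xy_yz] := lerP (c y z) (c x y).
    by right; apply: double => //; lra.
  by left; rewrite [c x w * _]mulrC; apply: double => //; lra.
- have [yz_zw|zw_yz] := lerP (c y z) (c z w).
    by right; apply: double => //; lra.
  by left; apply: double => //; lra.
Qed.

(** * The gauge and the metric axioms *)

Definition log_gauge {R : realType} {X : metricType R} {M : set X}
    (F : ~` M -> R) (x y : ~` M) : R :=
  mdist x y + Num.max (F x) (F y).

Section LogMetric.
Context {R : realType} {X : metricType R} {M : set X} {F : ~` M -> R}.
Hypothesis F_gt0 : forall x, 0 < F x.
Implicit Types (x y z w : ~` M) (r s K : R).

Let v := log_metric F.
Local Notation c := (log_gauge F).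


Lemma log_gauge_gt0 x y : 0 < c x y.
Proof. by rewrite ltr_wpDl ?mdist_ge0// lt_max F_gt0. Qed.

Lemma log_gauge_sym x y : c x y = c y x.
Proof. by rewrite /log_gauge metric_sym maxC. Qed.

Lemma log_gauge_triangle y x z : c x z <= c x y + c y z.
Proof.
rewrite /log_gauge; have := metric_triangle x y z.
have := F_gt0 x; have := F_gt0 y; have := F_gt0 z.
by case: (leP (F x) (F z)); case: (leP (F x) (F y)); case: (leP (F y) (F z));
  lra.
Qed.

(** Expanding the right-hand side, [F y] is below both maxima, which handles
    the terms in [d]; and [max (F x) (F z) * F y] is below the product of the
    maxima since one of them dominates the larger of [F x], [F z] and the
    other one dominates [F y]. *)
Lemma log_gauge_weighted_triangle y x z : c x z * F y <= c x y * c y z.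
Proof.
have a0 := mdist_ge0 x y; have b0 := mdist_ge0 y z.
have Fx := F_gt0 x; have Fy := F_gt0 y; have Fz := F_gt0 z.
have xy_Fx : F x <= Num.max (F x) (F y) by rewrite le_max lexx.
have xy_Fy : F y <= Num.max (F x) (F y) by rewrite le_max lexx orbT.
have yz_Fy : F y <= Num.max (F y) (F z) by rewrite le_max lexx.
have yz_Fz : F z <= Num.max (F y) (F z) by rewrite le_max lexx orbT.
have max_le :
    Num.max (F x) (F z) * F y <= Num.max (F x) (F y) * Num.max (F y) (F z).
  case: (leP (F x) (F z)) => _; first by rewrite mulrC ler_pM//; exact: ltW.
  by rewrite ler_pM//; exact: ltW.
rewrite /log_gauge.
apply: le_trans
  (_ : (mdist x y + mdist y z + Num.max (F x) (F z)) * F y <= _).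
  by rewrite (ler_wpM2r (ltW Fy))// lerD2r metric_triangle.
set m := Num.max (F x) (F y) in xy_Fx xy_Fy max_le *.
set n := Num.max (F y) (F z) in yz_Fy yz_Fz max_le *.
rewrite !mulrDl.
have h1 : mdist x y * F y <= mdist x y * n by rewrite ler_wpM2l.
have h2 : mdist y z * F y <= m * mdist y z by rewrite [m * _]mulrC ler_wpM2l.
rewrite !mulrDr.
have h3 : 0 <= mdist x y * mdist y z by rewrite mulr_ge0.
lra.
Qed.

Lemma log_metricE x y : v x y = 2 * ln (c x y) - ln (F x) - ln (F y).
Proof.
have FF : 0 < F x * F y by rewrite mulr_gt0.
rewrite /v /log_metric ln_div ?posrE ?sqrtr_gt0 ?log_gauge_gt0//.
have : ln (F x * F y) = 2 * ln (Num.sqrt (F x * F y)).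
  by rewrite -{1}(sqr_sqrtr (ltW FF)) lnXn ?sqrtr_gt0// mulr_natl.
rewrite lnM ?posrE//; rewrite /log_gauge; lra.
Qed.

(** Exponentiated forms, free of logarithms and square roots: all later
    comparisons of [v] with a number go through them. *)
Lemma log_metric_leE K x y : 0 < K ->
  (v x y <= ln K) = (c x y ^+ 2 <= K * (F x * F y)).
Proof.
move=> K0; have FF : 0 < F x * F y by rewrite mulr_gt0.
have cc := log_gauge_gt0 x y.
rewrite -[RHS]ler_ln ?posrE ?mulr_gt0 ?exprn_gt0// lnXn// !lnM ?posrE//.
rewrite log_metricE -mulr_natl; apply/idP/idP; lra.
Qed.

Lemma log_metric_geE K x y : 0 < K ->
  (ln K <= v x y) = (K * (F x * F y) <= c x y ^+ 2).
Proof.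
move=> K0; have FF : 0 < F x * F y by rewrite mulr_gt0.
have cc := log_gauge_gt0 x y.
rewrite -[RHS]ler_ln ?posrE ?mulr_gt0 ?exprn_gt0// lnXn// !lnM ?posrE//.
rewrite log_metricE -mulr_natl; apply/idP/idP; lra.
Qed.

(** Points at [v]-distance zero coincide because [c x y ^ 2 <= F x * F y] leaves
    no room for a positive [d(x, y)] next to the maximum. *)
Lemma log_metric_is_metric : is_metric v.
Proof.
split.
- move=> x; rewrite log_metricE /log_gauge mdistxx add0r maxxx; lra.
- move=> x y v0; apply: mdist_positivity.
  have : v x y <= ln 1 by rewrite v0 ln1.
  rewrite log_metric_leE// mul1r /log_gauge.
  have d0 := mdist_ge0 x y; have Fx := F_gt0 x; have Fy := F_gt0 y.
  move: d0; set d := mdist x y => d0 h; apply/eqP; rewrite eq_le d0 andbT leNgt.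
  by apply/negP => d_gt0; move: h; case: (leP (F x) (F y)); nra.
- by move=> x y; rewrite !log_metricE log_gauge_sym; lra.
- move=> y x z; rewrite !log_metricE.
  have := log_gauge_weighted_triangle y x z.
  rewrite -ler_ln ?posrE ?mulr_gt0 ?log_gauge_gt0//.
  by rewrite !lnM ?posrE ?log_gauge_gt0//; lra.
Qed.

Lemma log_metric_gromov x y z w :
  v x z + v y w <= Num.max (v x w + v y z) (v x y + v z w) + 2 * ln 4.
Proof.
have c0 a b : 0 <= c a b by exact/ltW/log_gauge_gt0.
have four : (0 : R) < 4 by [].
rewrite -lerBlDr le_max !log_metricE; apply/orP.
have := four_point_product c0 log_gauge_sym log_gauge_triangle x y z w.
case=> h;
  [left|right]; move: h;
  rewrite -ler_ln ?posrE ?mulr_gt0 ?log_gauge_gt0//;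
  rewrite !lnM ?posrE ?mulr_gt0 ?log_gauge_gt0//;
  lra.
Qed.

(** * Comparison with the original distance *)

(** With [m = max (F x) (F y)] the hypothesis reads
    [(d + m)^2 <= (1 + s)^2 F x F y].  Bounding [F x F y] by [m^2] gives the
    estimate on [d]; bounding [d + m] below by [F y] and cancelling [F y]
    gives the one on [F y]. *)
Lemma log_metric_small s x y : 0 < s -> v x y <= ln ((1 + s) ^+ 2) ->
  mdist x y <= s * Num.max (F x) (F y) /\ F y <= (1 + s) ^+ 2 * F x.
Proof.
move=> s0; rewrite log_metric_leE ?exprn_gt0 ?addr_gt0// /log_gauge.
have d0 := mdist_ge0 x y; have Fx := F_gt0 x; have Fy := F_gt0 y.
set d := mdist x y in d0 *; set m := Num.max _ _ => h.
have mx : F x <= m by rewrite le_max lexx.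
have my : F y <= m by rewrite le_max lexx orbT.
have m0 : 0 < m by apply: lt_le_trans mx.
split.
  have : (d + m) ^+ 2 <= ((1 + s) * m) ^+ 2.
    rewrite exprMn (le_trans h)// ler_wpM2l ?sqr_ge0// expr2.
    by rewrite ler_pM//; exact: ltW.
  have sm0 : 0 <= (1 + s) * m by rewrite mulr_ge0; lra.
  by rewrite ler_pXn2r ?nnegrE//; lra.
rewrite -(ler_pM2r Fy) -mulrA; apply: le_trans h.
by rewrite expr2 ler_pM//; lra.
Qed.

(** By [ln (1 + a) <= a] it suffices that
    [(r + m)^2 <= (F x + 4 r) F y], where [m = max (F x) (F y)].  Both sides
    are quadratic, and the linear terms leave a margin which absorbs the
    quadratic ones when [r <= F x / 5].  The hypothesis on [F] is separate
    from the one on the distance so that the bound serves both Lipschitz and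
    merely continuous [F]. *)
Lemma log_metric_le_near r x y :
  mdist x y <= r -> `|F x - F y| <= r -> r <= F x / 5 ->
  v x y <= 4 * (r / F x).
Proof.
move=> dr Fr rF; have Fx := F_gt0 x; have Fy := F_gt0 y.
have d0 := mdist_ge0 x y.
have r0 : 0 <= r by apply: le_trans dr.
have u0 : 0 <= r / F x by rewrite divr_ge0 // ltW.
apply: le_trans (_ : ln (1 + 4 * (r / F x)) <= _); last by apply: le_ln1Dx; lra.
rewrite log_metric_leE; last lra.
have -> : (1 + 4 * (r / F x)) * (F x * F y) = (F x + 4 * r) * F y.
  by field; rewrite gt_eqF.
move: Fr; rewrite ler_distl => /andP[Fr1 Fr2].
rewrite /log_gauge; apply: le_trans (_ : (r + Num.max (F x) (F y)) ^+ 2 <= _).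
  by rewrite lerXn2r ?nnegrE ?addr_ge0 ?le_max ?(ltW Fx) ?lerD2r.
case: (leP (F x) (F y)) => h; nra.
Qed.

(** For [r <= F x] the smallest possible value of [c x y ^ 2 / (F x * F y)]
    with [d(x, y) >= r] is attained at [F y = F x], [d(x, y) = r], so
    [v x y >= 2 ln (1 + u)] with [u = r / F x]; and for [u <= 1/4],
    [2 ln (1 + u) >= 2 u / (1 + u) >= 8 u / 5]. *)
Lemma log_metric_ge_far r x y :
  0 < r -> r <= mdist x y -> r <= F x / 4 -> 8 / 5 * (r / F x) <= v x y.
Proof.
move=> r0 rd rF; have Fx := F_gt0 x; have Fy := F_gt0 y.
have u0 : 0 < r / F x by rewrite divr_gt0.
have u4 : r / F x <= 4^-1 by rewrite ler_pdivrMr// mulrC.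
apply: le_trans (_ : ln ((1 + r / F x) ^+ 2) <= _).
  set u := r / F x in u0 u4 *.
  rewrite lnXn; last lra.
  (* The lower bound ln (1 + u) >= u / (1 + u) is ln (1 + a) <= a at the
     point a for which 1 + a is the inverse of 1 + u. *)
  have : ln (1 + - (u / (1 + u))) <= - (u / (1 + u)).
    by apply: le_ln1Dx; rewrite ltrN2 ltr_pdivrMr; lra.
  have -> : 1 + - (u / (1 + u)) = (1 + u)^-1 by field; lra.
  rewrite lnV ?posrE; last lra.
  have : 4 / 5 * u <= u / (1 + u) by rewrite ler_pdivlMr; nra.
  rewrite -mulr_natl; lra.
rewrite log_metric_geE; last by rewrite exprn_gt0// addr_gt0.
apply: le_trans (_ : (r + Num.max (F x) (F y)) ^+ 2 <= _); last first.
  by rewrite lerXn2r ?nnegrE ?addr_ge0 ?le_max ?mdist_ge0 ?(ltW Fx) ?(ltW r0)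
    ?lerD2r.
rewrite -(ler_pM2r Fx).
have -> : (1 + r / F x) ^+ 2 * (F x * F y) * F x = (F x + r) ^+ 2 * F y.
  by field; rewrite gt_eqF.
case: (leP (F x) (F y)) => h.
  (* The difference of the two sides factors, with F x * F y >= r * r. *)
  rewrite -subr_ge0.
  have -> : (r + F y) ^+ 2 * F x - (F x + r) ^+ 2 * F y =
      (F y - F x) * (F x * F y - r * r) by ring.
  by rewrite mulr_ge0 ?subr_ge0// ler_pM//; lra.
by rewrite [r + _]addrC ler_wpM2l ?sqr_ge0// ltW.
Qed.

End LogMetric.
(** * Linear dilatation *)

Lemma limf_esup_le (T : choiceType) (Y : filteredType T) (R : realType)
    (f : Y -> \bar R) (G : set_system Y) (a : \bar R) :
  (\forall t \near G, (f t <= a)%E) -> (limf_esup f G <= a)%E.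
Proof.
move=> Gfa; apply: ge_ereal_inf.
exists (ereal_sup (f @` [set t | (f t <= a)%E])).
  by exists [set t | (f t <= a)%E].
by apply: ge_ereal_sup => _ [t /= ft <-].
Qed.

(** The numerator is nonnegative because it includes the term at [x] itself;
    the bound survives an infinite denominator, whose inverse is 0. *)
Lemma linear_dilatation_le {R : realType} {Y Z : metricType R} (f : Y -> Z)
    (x : Y) (r a b : R) :
  0 <= r -> 0 < b ->
  (forall y, mdist x y <= r -> mdist (f x) (f y) <= a) ->
  (forall y, r <= mdist x y -> b <= mdist (f x) (f y)) ->
  (linear_dilatation f x r <= (a / b)%:E)%E.
Proof.
move=> r0 b0 near far; rewrite /linear_dilatation EFinM.
set n := ereal_sup _; set d := ereal_inf _.
have n0 : (0 <= n)%E.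
  apply: le_ereal_sup_tmp; exists (mdist (f x) (f x))%:E.
    by exists x => //=; rewrite mdistxx.
  by rewrite mdistxx.
have bd : (b%:E <= d)%E.
  by apply: le_ereal_inf_tmp => _ [y /= ry <-]; rewrite lee_fin far.
have d0 : (0 <= d)%E by apply: le_trans bd; rewrite lee_fin ltW.
apply: lee_pmul => //; first by rewrite inve_ge0.
  by apply: ge_ereal_sup => _ [y /= yr <-]; rewrite lee_fin near.
have -> : (b^-1)%:E = (b%:E^-1)%E by rewrite inver gt_eqF.
by rewrite lee_pV2 ?inE//= lee_fin ltW.
Qed.

(** * Topology, quasiconformality and completeness *)

Section LogMetricTopology.
Context {R : realType} {X : metricType R} {M : set X} {F : ~` M -> R}.
Hypothesis F_gt0 : forall x, 0 < F x.
Variable v_metric : is_metric (log_metric F).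
Local Notation V := (metric_of v_metric).

(** Every [d]-ball around [x] contains a [v]-ball, without any assumption on
    the regularity of [F]. *)
Lemma log_metric_finer : continuous (fun x : V => x : ~` M).
Proof.
move=> x.
apply/(@metricType_numDomainType.cvgrPdist_lt _ _ _ _ (nbhs_filter (x : V))).
move=> r r0.
have Fx := F_gt0 x.
(* If s <= 1, a point y at v-distance less than 2 ln (1 + s) has F y <= 4 F x
   and so d(x, y) <= 4 s F x < r. *)
pose s := Num.min 1 (r / (8 * F x)).
have s0 : 0 < s by rewrite lt_min ltr01 divr_gt0// mulr_gt0.
have s1 : s <= 1 by rewrite ge_min lexx.
have sr : s * (8 * F x) <= r.
  by rewrite -ler_pdivlMr ?mulr_gt0// ge_min lexx orbT.
apply/(@metricType_numDomainType.nbhs_mdistP _ V).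
exists (ln ((1 + s) ^+ 2)) => /=; first by rewrite ln_gt0// exprn_egt1// ltrDl.
move=> y /= /ltW /(log_metric_small F_gt0 s0)[dxy Fxy].
have sFx : 0 < s * F x by rewrite mulr_gt0.
have Fy4 : F y <= 4 * F x.
  by apply: le_trans Fxy _; rewrite ler_wpM2r ?(ltW Fx)//; nra.
have sFy : s * F y <= s * (4 * F x) by rewrite ler_wpM2l// ltW.
by apply: le_lt_trans dxy _; case: (leP (F x) (F y)) => _; lra.
Qed.

(** Convergence for [v] follows from convergence for [d] together with that of
    the values of [F]; the filter is arbitrary so as to cover both continuity
    of the identity and limits of sequences. *)
Lemma log_metric_cvg {I : Type} {G : set_system I} {GG : Filter G}
    (u : I -> ~` M) (x : ~` M) :
  u @ G --> x -> F (u i) @[i --> G] --> F x -> (u : I -> V) @ G --> (x : V).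
Proof.
move=> ux Fux; apply/metricType_numDomainType.cvgrPdist_le => e e0.
have Fx := F_gt0 x.
pose r := Num.min (F x / 5) (e * F x / 4).
have r0 : 0 < r by rewrite lt_min !divr_gt0// mulr_gt0.
near=> i.
have re : 4 * (r / F x) <= e.
  rewrite mulrA ler_pdivrMr// [4 * _]mulrC -ler_pdivlMr//.
  by rewrite /r ge_min lexx orbT.
apply: le_trans re; apply: (log_metric_le_near F_gt0) => //.
- by near: i; exact: (metricType_numDomainType.cvgr_dist_le ux).
- by near: i; move/cvgrPdist_le: Fux; apply.
- by rewrite /r ge_min lexx.
Unshelve. all: by end_near. Qed.

(** The role of [Ft = 0] on [M] is to keep the limit in [X] away from [M]:
    [F] is bounded below along a [v]-Cauchy sequence. *)
Lemma log_metric_complete (Ft : X -> R) :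
  continuous Ft -> (forall x : ~` M, Ft (set_val x) = F x) ->
  (forall x : X, M x -> Ft x = 0) ->
  complete_metric X -> complete_metric V.
Proof.
move=> Ft_cont FtE Ft0 X_complete u u_cauchy.
have /cauchy_ballP u_ball := u_cauchy.
have ln2 (s : R) : 0 < s -> 0 < ln ((1 + s) ^+ 2).
  by move=> s0; rewrite ln_gt0// exprn_egt1// ltrDl.
(* A point a that is eventually at v-distance less than ln 4 from the
   sequence; this makes F comparable with F a along the sequence. *)
have [a F_cmp] : exists a : ~` M,
    \forall n \near \oo, F (u n) <= 4 * F a /\ F a <= 4 * F (u n).
  have [a ua] := (cauchyP (u n @[n --> \oo])).1 u_cauchy _ (ln2 1 ltr01).
  rewrite ballEmdist in ua; exists a.
  apply: (@filterS _ \oo _ _ _ _ ua) => n /= /ltW uan.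
  have e4 : (1 + 1) ^+ 2 = 4 :> R by ring.
  have [_ ] := log_metric_small F_gt0 ltr01 uan; rewrite e4 => ->; split => //.
  have := uan; rewrite metric_sym => una.
  by have [_ ] := log_metric_small F_gt0 ltr01 una; rewrite e4.
have Fa := F_gt0 a.
have w_cauchy : cauchy (set_val (u n : ~` M) @[n --> \oo]).
  apply/cauchyP => e e0.
  (* As F <= 4 F a along the sequence, the d-distances are at most
     4 s F a, and the 5 makes this strictly less than e. *)
  pose s := e / (5 * F a).
  have s0 : 0 < s by rewrite divr_gt0// mulr_gt0.
  have [[A B] [/= uA uB] AB] := u_ball _ (ln2 _ s0).
  have [n0 [An0 [Fn0 _]]] := filter_ex (@filterI _ \oo _ _ _ uA F_cmp).
  exists (set_val (u n0 : ~` M)).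
  apply: (@filterS _ \oo _ _ _ _ (@filterI _ \oo _ _ _ uB F_cmp)).
  move=> n [Bn [Fn _]].
  rewrite /= ballEmdist /=.
  have := AB (u n0, u n) (conj An0 Bn).
  rewrite ballEmdist /= => /ltW /(log_metric_small F_gt0 s0)[d_le _].
  apply: le_lt_trans d_le _; apply: le_lt_trans (_ : s * (4 * F a) < _).
    by rewrite ler_wpM2l ?(ltW s0)// ge_max Fn0.
  have -> : e = s * (5 * F a) by rewrite /s divfK// gt_eqF// mulr_gt0.
  by rewrite ltr_pM2l// ltr_pM2r// ltr_nat.
have [l ul] := X_complete _ w_cauchy.
have Ful : F (u n) @[n --> \oo] --> Ft l.
  have := cvg_comp _ _ ul (Ft_cont l).
  by rewrite /comp; under eq_fun do rewrite FtE.
have Ml : (~` M) l.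
  move=> /Ft0 Ftl; rewrite Ftl in Ful.
  have Fa4 : 0 < F a / 4 by rewrite divr_gt0.
  have [n [Fn [_ Fan]]] := filter_ex (filterI (cvgr_lt _ Ful _ Fa4) F_cmp).
  move: Fn; lra.
pose y : ~` M := SigSub (mem_set Ml).
exists y; apply: log_metric_cvg.
  apply/metricType_numDomainType.cvgrPdist_lt => e e0.
  exact: (metricType_numDomainType.cvgr_dist_lt ul).
by rewrite -FtE.
Qed.

(** The identity is a bijection, so openness is continuity of its inverse. *)
Lemma log_metric_open_map : open_map (id_metric_of v_metric).
Proof.
move=> U Uo.
have -> : id_metric_of v_metric @` U = (fun x : V => x : ~` M) @^-1` U.
  by apply/seteqP; split => [_ [x Ux <-]//|x Ux]; exists x.
by move/continuousP: log_metric_finer; apply.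
Qed.

Lemma log_metric_quasiconformal :
  (forall x y : ~` M, `|F x - F y| <= mdist x y) ->
  quasiconformal (5 / 2) (id_metric_of v_metric).
Proof.
move=> F_lip; split; first by [].
  split.
    move=> x; apply: (@log_metric_cvg _ _ (nbhs_filter x) id x).
      exact: cvg_id.
    apply/cvgrPdist_le => e e0.
    apply/(@metricType_numDomainType.nbhs_mdistP _ (~` M)).
    exists e => //= y /= xy.
    by rewrite (le_trans (F_lip _ _))// ltW.
  by exists (fun x : V => x : ~` M); split => //; exact: log_metric_finer.
move=> x; have Fx := F_gt0 x.
apply: limf_esup_le; near=> r.
have r0 : 0 < r by near: r; exact: nbhs_right_gt.
have r5 : r <= F x / 5.
  by near: r; apply: nbhs_right_le; rewrite divr_gt0.
have u0 : 0 < r / F x by rewrite divr_gt0.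
(* The values 4 u and 8 u / 5, with u = r / F x, bound v from above inside
   and from below outside the ball of radius r. *)
have -> : 5 / 2 = (4 * (r / F x)) / (8 / 5 * (r / F x)) :> R.
  by field; rewrite !gt_eqF.
apply: linear_dilatation_le; first exact: ltW.
- by rewrite mulr_gt0.
- move=> y xy; apply: (log_metric_le_near F_gt0) => //.
  exact: le_trans (F_lip _ _) xy.
- by move=> y xy; apply: (log_metric_ge_far F_gt0) => //; lra.
Unshelve. all: by end_near. Qed.

End LogMetricTopology.

Theorem theorem16 (R : realType) (X : metricType R) (M : set X)
    (M_nonempty : M !=set0) (M_closed : closed M) (M_proper : M != setT)
    (F : ~` M -> R) (F_gt0 : forall x : ~` M, 0 < F x) :
  exists v_metric : is_metric (log_metric F),
    [/\ (exists2 delta : R, delta <= ln 4 &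
           gromov_constant (metric_of v_metric) delta) /\
        open_map (id_metric_of v_metric),
        (forall x y : ~` M, `|F x - F y| <= mdist x y) ->
          quasiconformal (5 / 2) (id_metric_of v_metric)
      & (exists Ft : X -> R,
           [/\ continuous Ft,
               forall x : ~` M, Ft (set_val x) = F x
             & forall x : X, M x -> Ft x = 0]) ->
        complete_metric X -> complete_metric (metric_of v_metric)].
Proof.
exists (log_metric_is_metric F_gt0); split.
- split; last exact: log_metric_open_map.
  exists (ln 4) => //; split; first by rewrite ln_ge0// ler1n.
  exact: log_metric_gromov.
- exact: log_metric_quasiconformal.
- by case=> Ft [Ft_cont FtE Ft0]; exact: log_metric_complete FtE Ft0.
Qed.
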